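(* Let $H \in \{P_3\cup P_1,\ K_2\cup 2K_1\}$. If $G$ is an $H$-free graph, then $\gamma_s(G) \le \max\{3,\alpha(G)\}$.
   Context: All graphs are finite, simple and undirected (and not necessarily connected). $P_n$ and $K_n$ denote the path and the complete graph on $n$ vertices; $G_1\cup G_2$ denotes the disjoint union of vertex-disjoint graphs $G_1$ and $G_2$, and $mG$ the disjoint union of $m$ copies of $G$. For a graph $H$, a graph is $H$-free if it has no induced subgraph isomorphic to $H$. A set $S\subseteq V(G)$ is a dominating set of $G$ if every vertex of $V(G)\setminus S$ is adjacent to at least one vertex of $S$. A secure dominating set of $G$ is a dominating set $S$ of $G$ such that for every $v\in V(G)\setminus S$ there is a neighbor $u$ of $v$ in $S$ such that $(S\setminus\{u\})\cup\{v\}$ is a dominating set of $G$. The secure domination number $\gamma_s(G)$ is the minimum cardinality of a secure dominating set of $G$, and the independence number $\alpha(G)$ is the maximum cardinality of an independent set of $G$. *)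

(* Defs.v *)
From mathcomp Require Import all_boot.

Set Implicit Arguments.
Unset Strict Implicit.
Unset Printing Implicit Defensive.

Record sgraph := SGraph {
  vertex :> finType;
  adj : rel vertex;
  adj_sym : symmetric adj;
  adj_irrefl : irreflexive adj }.

Fact path_adj_sym n : symmetric (fun i j : 'I_n => (i.+1 == j) || (j.+1 == i)).
Proof. by move=> i j; rewrite orbC. Qed.
Fact path_adj_irrefl n :
  irreflexive (fun i j : 'I_n => (i.+1 == j) || (j.+1 == i)).
Proof. by move=> i; rewrite orbb gtn_eqF. Qed.
Definition path_graph n := SGraph (@path_adj_sym n) (@path_adj_irrefl n).

Fact complete_adj_sym n : symmetric (fun i j : 'I_n => i != j).
Proof. by move=> i j; rewrite eq_sym. Qed.
Fact complete_adj_irrefl n : irreflexive (fun i j : 'I_n => i != j).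
Proof. by move=> i; rewrite eqxx. Qed.
Definition complete_graph n :=
  SGraph (@complete_adj_sym n) (@complete_adj_irrefl n).

Definition union_adj (G1 G2 : sgraph) (x y : G1 + G2) : bool :=
  match x, y with
  | inl a, inl b => adj a b
  | inr a, inr b => adj a b
  | _, _ => false
  end.
Fact union_adj_sym G1 G2 : symmetric (@union_adj G1 G2).
Proof. by move=> [a|a] [b|b] //=; rewrite adj_sym. Qed.
Fact union_adj_irrefl G1 G2 : irreflexive (@union_adj G1 G2).
Proof. by move=> [a|a] /=; rewrite adj_irrefl. Qed.
Definition disjoint_union G1 G2 :=
  SGraph (@union_adj_sym G1 G2) (@union_adj_irrefl G1 G2).

(* The vertex (i, x) is the vertex x of the i-th copy of G. *)
Definition copies_adj m (G : sgraph) (p q : 'I_m * G) : bool :=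
  (p.1 == q.1) && adj p.2 q.2.
Fact copies_adj_sym m G : symmetric (@copies_adj m G).
Proof. by move=> p q; rewrite /copies_adj eq_sym adj_sym. Qed.
Fact copies_adj_irrefl m G : irreflexive (@copies_adj m G).
Proof. by move=> p; rewrite /copies_adj adj_irrefl andbF. Qed.
Definition copies m G := SGraph (@copies_adj_sym m G) (@copies_adj_irrefl m G).

Definition induced_adj (G : sgraph) (S : {set G}) (x y : {x : G | x \in S}) : bool :=
  adj (val x) (val y).
Fact induced_adj_sym (G : sgraph) (S : {set G}) : symmetric (@induced_adj G S).
Proof. by move=> x y; apply: adj_sym. Qed.
Fact induced_adj_irrefl (G : sgraph) (S : {set G}) : irreflexive (@induced_adj G S).
Proof. by move=> x; apply: adj_irrefl. Qed.
Definition induced (G : sgraph) (S : {set G}) :=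
  SGraph (@induced_adj_sym G S) (@induced_adj_irrefl G S).

Definition isomorphic (G1 G2 : sgraph) : Prop :=
  exists2 f : G1 -> G2, bijective f & {mono f : x y / adj x y}.

Definition free_of (H G : sgraph) : Prop :=
  ~ exists S : {set G}, isomorphic (induced S) H.

Definition dominating (G : sgraph) (S : {set G}) : bool :=
  [forall v in ~: S, [exists u in S, adj v u]].

Definition secure_dominating (G : sgraph) (S : {set G}) : bool :=
  dominating S &&
  [forall v in ~: S,
    [exists u in S, adj v u && dominating ((S :\ u) :|: [set v])]].

Fact secure_dominating_setT (G : sgraph) : secure_dominating [set: G].
Proof.
by apply/andP; split; apply/forall_inP=> v; rewrite setCT inE.
Qed.

(* [set: G] is only the seed required by arg min; it is a secure dominating
   set by secure_dominating_setT, so the minimum is attained. *)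
Definition secure_domination_number (G : sgraph) : nat :=
  #|[arg min_(S < [set: G] | secure_dominating S) #|S|]|.

Definition independent (G : sgraph) (S : {set G}) : bool :=
  [forall x in S, forall y in S, ~~ adj x y].

Definition independence_number (G : sgraph) : nat :=
  \max_(S : {set G} | independent S) #|S|.

(* Main.v *)
Require Import Defs.
From mathcomp Require Import all_boot.

(** A maximum independent set is dominating, and so is every set containing
    one ([maximum_independent_dominating]); this drives the whole argument.

    If the independence number is at least 3, every maximum independent set S
    is itself secure dominating.  A vertex x outside S has a neighbour in S, so
    forbidding one of the two graphs limits how x may attach to S.  Without an
    induced K_2 + 2K_1, the vertex x misses at most one element of S; removing
    any u from S leaves at least two elements, one of which is adjacent to x,
    and hence every swap is harmless.  Without an induced P_3 + P_1, the vertex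
    x sees either exactly one element u of S, and swapping u for x gives another
    maximum independent set, or all of S, and then any swap works: a vertex y
    left undominated would be isolated from a path v - x - w with v, w in S.

    If the independence number is at most 2, no graph need be excluded.  In
    a complete graph a single vertex is secure dominating.  Otherwise each pair
    of distinct non-adjacent vertices is a maximum independent set, hence
    dominating, and any three vertices u, v, w with u, v non-adjacent form
    a secure dominating set: see [independence_le2_bound]. *)

Set Implicit Arguments.
Unset Strict Implicit.
Unset Printing Implicit Defensive.

Section Graph.

Variable G : sgraph.
Implicit Types (S T : {set G}) (a b c d u v w x y : G).

(** * Secure domination and maximum independent sets *)

Lemma dominatingP S :
  reflect (forall v, v \notin S -> exists2 u, u \in S & adj v u)
          (dominating S).
Proof.
apply: (iffP forall_inP) => h v hv.
  by apply/exists_inP/h; rewrite inE.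
by apply/exists_inP/h; rewrite inE in hv.
Qed.

Lemma secure_dominatingI S :
    dominating S ->
    (forall v, v \notin S ->
       exists u, [/\ u \in S, adj v u & dominating ((S :\ u) :|: [set v])]) ->
  secure_dominating S.
Proof.
move=> domS swapS; rewrite /secure_dominating domS /=.
apply/forall_inP => v; rewrite inE => /swapS [u [uS vu domT]].
by apply/exists_inP; exists u; rewrite // vu.
Qed.

Lemma secure_domination_number_le S :
  secure_dominating S -> secure_domination_number G <= #|S|.
Proof.
move=> secS; rewrite /secure_domination_number.
by case: arg_minnP => [|T _ minT]; [exact: secure_dominating_setT|exact: minT].
Qed.

Lemma independentP S :
  reflect {in S &, forall x y, ~~ adj x y} (independent S).
Proof.
apply: (iffP forall_inP) => [h x y xS yS|h x xS].
  exact: (forall_inP (h x xS)).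
by apply/forall_inP => y; apply: h.
Qed.

Lemma independentU1 S x :
    independent S -> {in S, forall y, ~~ adj x y} ->
  independent (x |: S).
Proof.
move=> /independentP indS xS; apply/independentP => y z.
move=> /setU1P [->|yS] /setU1P [->|zS]; last exact: indS.
- by rewrite adj_irrefl.
- exact: xS.
- by rewrite adj_sym xS.
Qed.

Lemma independent_subset S T : T \subset S -> independent S -> independent T.
Proof.
move=> /subsetP sTS /independentP indS; apply/independentP => x y xT yT.
by apply: indS; apply: sTS.
Qed.

Lemma independent_pair u v : ~~ adj u v -> independent [set u; v].
Proof.
move=> uv; apply/independentP => x y /set2P [->|->] /set2P [->|->] //.
- by rewrite adj_irrefl.
- by rewrite adj_sym.
- by rewrite adj_irrefl.
Qed.

Lemma independent_card S : independent S -> #|S| <= independence_number G.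
Proof. by move=> indS; apply: (@leq_bigmax_cond _ _ (fun T => #|T|)). Qed.

Lemma maximum_independent_exists :
  exists2 S : {set G}, independent S & #|S| = independence_number G.
Proof.
have ind0 : independent (set0 : {set G}).
  by apply/independentP => x y; rewrite inE.
have gt0 : 0 < #|[pred T : {set G} | independent T]|.
  by apply/card_gt0P; exists set0.
have [S indS maxS] := eq_bigmax_cond (fun T : {set G} => #|T|) gt0.
by exists S; rewrite // -maxS.
Qed.

(** An undominated vertex could be added to [S]; passing to supersets is what
    allows the same fact to be applied to sets that merely contain
    a non-adjacent pair when the independence number is 2. *)
Lemma maximum_independent_dominating S T :
    independent S -> independence_number G <= #|S| -> S \subset T ->
  dominating T.
Proof.
move=> indS maxS sST; apply/dominatingP => v vT.
have vS : v \notin S by apply: contra vT; apply: (subsetP sST).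
have [[u uS vu]|nov] := altP (@exists_inP _ (mem S) (adj v)).
  by exists u; rewrite // (subsetP sST).
have indvS : independent (v |: S).
  apply: independentU1 => // u uS; apply: contra nov => vu.
  by apply/exists_inP; exists u.
have := leq_trans (independent_card indvS) maxS.
by rewrite cardsU1 vS ltnn.
Qed.

(** * Independence number at most 2 *)

Lemma nonadjacent_pair_dominating u v T :
    independence_number G <= 2 -> u != v -> ~~ adj u v ->
    u \in T -> v \in T ->
  dominating T.
Proof.
move=> alpha2 neq_uv uv uT vT.
apply: (maximum_independent_dominating (independent_pair uv)).
  by rewrite cards2 neq_uv.
by apply/subsetP => x /set2P [->|->].
Qed.

Lemma complete_secure_dominating u :
  (forall x y, x != y -> adj x y) -> secure_dominating [set u].
Proof.
move=> complG; have dom1 x T : x \in T -> dominating T.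
  move=> xT; apply/dominatingP => y yT; exists x => //.
  by apply: complG; apply: contraNneq yT => ->.
apply: secure_dominatingI => [|v]; first exact/(dom1 u)/set11.
rewrite inE => vu.
exists u; split; first exact: set11.
  exact: complG.
by apply: (dom1 v); rewrite !inE eqxx orbT.
Qed.

(** The triple is secure because of the following choice of swap.  A vertex [x]
    that misses some [z] of the triple replaces one of its neighbours, so the
    new set contains the non-adjacent pair [x], [z]; a vertex adjacent to the
    whole triple replaces [w], which preserves the pair [u], [v]. *)
Lemma nonadjacent_triple_secure u v w :
    independence_number G <= 2 -> u != v -> ~~ adj u v ->
    w != u -> w != v ->
  secure_dominating [set u; v; w].
Proof.
move=> alpha2 neq_uv uv wu wv; set S := [set u; v; w].
have uS : u \in S by rewrite !inE eqxx.
have vS : v \in S by rewrite !inE eqxx orbT.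
have wS : w \in S by rewrite !inE eqxx orbT.
have domS : dominating S := nonadjacent_pair_dominating alpha2 neq_uv uv uS vS.
apply: secure_dominatingI => // x xS.
have [allx|] := boolP [forall z in S, adj x z].
  exists w; split=> //; first exact: (forall_inP allx).
  apply: (nonadjacent_pair_dominating alpha2 neq_uv uv);
    by rewrite !inE eqxx ?orbT /= andbT eq_sym ?wu ?wv.
case/forall_inPn => z zS xz; have [y yS xy] := dominatingP _ domS x xS.
have xNz : x != z by apply: contraNneq xS => ->.
have zNy : z != y by apply: contraNneq xz => ->.
exists y; split=> //; apply: (nonadjacent_pair_dominating alpha2 xNz xz).
  by rewrite !inE eqxx orbT.
by rewrite in_setU in_setD1 zNy zS.
Qed.

Lemma independence_le2_bound :
  independence_number G <= 2 -> secure_domination_number G <= 3.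
Proof.
move=> alpha2; have [small|big] := leqP #|G| 3.
  rewrite -cardsT in small; apply: leq_trans small.
  exact/secure_domination_number_le/secure_dominating_setT.
have [/existsP [u /existsP [v /andP [neq_uv uv]]]|compl] :=
  boolP [exists u : G, exists v : G, (u != v) && ~~ adj u v].
  have [w] : exists w, w \notin [set u; v].
    apply/existsP; apply: contraTT big => /existsPn all_uv; rewrite -leqNgt.
    rewrite -cardsT; apply: (@leq_trans #|[set u; v]|); last by rewrite cards2 neq_uv.
    by apply/subset_leq_card/subsetP => x _; have := all_uv x; rewrite negbK.
  rewrite !inE negb_or => /andP [wu wv].
  apply: leq_trans
    (secure_domination_number_le (nonadjacent_triple_secure alpha2 neq_uv uv wu wv)) _.
  apply: leq_trans (leq_card_setU _ _) _.
  by rewrite cards1 addn1 cards2 neq_uv.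
have [u _] : exists u, u \in G by apply/card_gt0P; apply: leq_trans big.
have complG x y : x != y -> adj x y.
  move=> xy; have /existsPn/(_ y) := existsPn compl x.
  by rewrite xy negbK.
apply: leq_trans (secure_domination_number_le (complete_secure_dominating u complG)) _.
by rewrite cards1.
Qed.

(** * Independence number at least 3 *)

Lemma card_gt2_other S u v :
  2 < #|S| -> exists2 w, w \in S & (w != u) && (w != v).
Proof.
move=> S3; have : 0 < #|S :\ u :\ v|.
  rewrite -(ltn_add2l 2) addn0; apply: leq_trans S3 _.
  rewrite (cardsD1 u S) (cardsD1 v (S :\ u)) addnA leq_add2r.
  by case: (u \in S); case: (v \in S :\ u).
by case/card_gt0P => w; rewrite !inE => /and3P [wv wu wS]; exists w; rewrite ?wu.
Qed.

(** Besides [v] itself, which becomes a member, only the vertices outside [S]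
    can lose their dominator in the swap: [u] sees [v]. *)
Lemma swap_dominating S u v :
    adj v u ->
    (forall y, y \notin S -> y != v ->
       adj y v \/ exists2 w, w \in S & (w != u) && adj y w) ->
  dominating ((S :\ u) :|: [set v]).
Proof.
move=> vu domS; apply/dominatingP => y.
rewrite !inE negb_or negb_and negbK => /andP [yuS yv].
have [->|yu] := eqVneq y u.
  by exists v; rewrite ?inE ?eqxx ?orbT // adj_sym.
rewrite (negbTE yu) /= in yuS; have [yv'|[w wS /andP [wu yw]]] := domS y yuS yv.
  by exists v; rewrite ?inE ?eqxx ?orbT.
by exists w; rewrite // !inE wu wS.
Qed.

(** Excluding [K_2 + 2K_1] makes [S] doubly dominating: a vertex outside [S]
    that missed two elements of [S] would form, with them and with any of its
    neighbours in [S], the excluded graph.  Since [S] has three elements, no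
    single removal leaves a vertex outside [S] undominated. *)
Lemma maximum_independent_secure_of_K2_2K1 S :
    (forall a b c d, adj a b -> c != d -> ~~ adj a c -> ~~ adj a d ->
       ~~ adj b c -> ~~ adj b d -> ~~ adj c d -> False) ->
    independent S -> independence_number G <= #|S| -> 2 < #|S| ->
  secure_dominating S.
Proof.
move=> noH indS maxS S3.
have domS := maximum_independent_dominating indS maxS (subxx S).
move/independentP: indS => indS.
have miss1 x c d :
    x \notin S -> c \in S -> d \in S -> c != d -> adj x c || adj x d.
  move=> xS cS dS cd; apply/negPn; rewrite negb_or; apply/negP => /andP [xc xd].
  have [b bS xb] := dominatingP _ domS x xS.
  by apply: (noH x b c d) => //; apply: indS.
apply: secure_dominatingI => // x xS; have [u uS xu] := dominatingP _ domS x xS.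
exists u; split=> //; apply: swap_dominating => // y yS _; right.
have [c cS /andP [cu _]] := card_gt2_other u u S3.
have [d dS /andP [du dc]] := card_gt2_other u c S3.
have /orP [yc|yd] := miss1 y d c yS dS cS dc.
  by exists d; rewrite // du.
by exists c; rewrite // cu.
Qed.

(** Excluding [P_3 + P_1] leaves two kinds of vertices outside [S], private
    neighbours of one element and vertices complete to [S]: two neighbours and
    a non-neighbour in [S] would give the excluded graph, with the vertex as
    centre of the path.  Swapping in a private neighbour keeps the set
    independent and of maximum size.  A complete vertex swapped in is adjacent
    to every private neighbour of the removed vertex: one that it missed would
    be isolated from a path through it between two remaining elements. *)
Lemma maximum_independent_secure_of_P3_P1 S :
    (forall a b c d, adj a b -> adj b c -> a != c -> ~~ adj a c ->
       ~~ adj a d -> ~~ adj b d -> ~~ adj c d -> False) ->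
    independent S -> independence_number G <= #|S| -> 2 < #|S| ->
  secure_dominating S.
Proof.
move=> noH indS maxS S3.
have domS := maximum_independent_dominating indS maxS (subxx S).
have /independentP nadjS := indS.
have one_or_all x c d e : x \notin S -> c \in S -> d \in S -> e \in S ->
    c != d -> adj x c -> adj x d -> adj x e.
  move=> xS cS dS eS cd xc xd; apply/negPn/negP => xe.
  by apply: (noH c x d e) => //; rewrite 1?adj_sym //; apply: nadjS.
apply: secure_dominatingI => // x xS; have [u uS xu] := dominatingP _ domS x xS.
exists u; split=> //.
have [/existsP [v /and3P [vS vu xv]]|only_u] :=
    boolP [exists v, [&& v \in S, v != u & adj x v]].
  have allx e : e \in S -> adj x e.
    by move=> eS; apply: (one_or_all x v u).
  apply: swap_dominating => // y yS yx.
  have [w wS /andP [wu wv]] := card_gt2_other u v S3.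
  have [yv|yv] := boolP (adj y v); first by right; exists v; rewrite ?vu.
  have [yw|yw] := boolP (adj y w); first by right; exists w; rewrite ?wu.
  (* Here y misses v and w, so the path v - x - w forces y to see x. *)
  left; apply/negPn/negP => nyx.
  apply: (noH v x w y); rewrite 1?[adj _ y]adj_sym ?allx //.
  - by rewrite adj_sym allx.
  - by rewrite eq_sym.
  - exact: nadjS.
(* Now u is the only neighbour of x in S. *)
have indT : independent (x |: (S :\ u)).
  apply: independentU1 => [|y]; first exact: independent_subset (subD1set S u) indS.
  rewrite !inE => /andP [yu yS]; apply: contra only_u => xy.
  by apply/existsP; exists y; rewrite yS yu.
rewrite setUC; apply: maximum_independent_dominating indT _ (subxx _).
by rewrite cardsU1 !inE (negbTE xS) andbF; rewrite (cardsD1 u) uS in maxS.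
Qed.

(** * Realizing the forbidden induced subgraphs *)

(** [free_of] asks for an isomorphism from an induced subgraph onto [H],
    whereas concrete configurations are maps from [H]: an injective,
    adjacency-preserving-and-reflecting map is inverted on its image. *)
Lemma free_of_embedding (H : sgraph) (g : H -> G) :
  free_of H G -> injective g -> ~ {mono g : x y / adj x y}.
Proof.
move=> freeH injg monog; apply: freeH.
pose T := [set g h | h in H].
pose g' (h : H) : {x : G | x \in T} := exist _ (g h) (imset_f g (isT : h \in H)).
have injg' : injective g' by move=> h k /(congr1 val) /injg.
have [f g'K fK] : bijective g'.
  by apply: inj_card_bij injg' _; rewrite card_sig card_imset.
exists T; exists f; first by exists g'.
by move=> x y; rewrite -{2}(fK x) -{2}(fK y) /= /induced_adj /= monog.
Qed.

Lemma P3_P1_free a b c d :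
    free_of (disjoint_union (path_graph 3) (path_graph 1)) G ->
    adj a b -> adj b c -> a != c -> ~~ adj a c ->
    ~~ adj a d -> ~~ adj b d -> ~~ adj c d ->
  False.
Proof.
move=> freeH ab bc neq_ac ac ad bd cd.
have neq_ab : a != b by apply: contraTneq ab => ->; rewrite adj_irrefl.
have neq_bc : b != c by apply: contraTneq bc => ->; rewrite adj_irrefl.
have neq_ad : a != d by apply: contraNneq bd => <-; rewrite adj_sym.
have neq_bd : b != d by apply: contraNneq ad => <-.
have neq_cd : c != d by apply: contraNneq bd => <-.
pose g (h : disjoint_union (path_graph 3) (path_graph 1)) : G :=
  match h with inl i => nth a [:: a; b; c] (i : 'I_3) | inr _ => d end.
apply: (free_of_embedding (g := g) freeH).
  move=> [[[|[|[|//]]] ?]|[[|//] ?]] [[[|[|[|//]]] ?]|[[|//] ?]] //= /eqP;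
    rewrite ?[_ == a]eq_sym ?[d == _]eq_sym ?[c == b]eq_sym;
    rewrite ?(negbTE neq_ab) ?(negbTE neq_bc) ?(negbTE neq_ac);
    rewrite ?(negbTE neq_ad) ?(negbTE neq_bd) ?(negbTE neq_cd) // => _;
  by [congr inl; apply: val_inj | congr inr; apply: val_inj].
move=> [[[|[|[|//]]] ?]|[[|//] ?]] [[[|[|[|//]]] ?]|[[|//] ?]] /=;
  by rewrite ?adj_irrefl ?ab ?bc ?(negbTE ac) ?(negbTE ad) ?(negbTE bd)
       ?(negbTE cd) // adj_sym ?ab ?bc ?(negbTE ac) ?(negbTE ad) ?(negbTE bd)
       ?(negbTE cd).
Qed.

Lemma K2_2K1_free a b c d :
    free_of (disjoint_union (complete_graph 2) (copies 2 (complete_graph 1))) G ->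
    adj a b -> c != d -> ~~ adj a c -> ~~ adj a d ->
    ~~ adj b c -> ~~ adj b d -> ~~ adj c d ->
  False.
Proof.
move=> freeH ab neq_cd ac ad bc bd cd.
have neq_ab : a != b by apply: contraTneq ab => ->; rewrite adj_irrefl.
have neq_ac : a != c by apply: contraNneq bc => <-; rewrite adj_sym.
have neq_ad : a != d by apply: contraNneq bd => <-; rewrite adj_sym.
have neq_bc : b != c by apply: contraNneq ac => <-.
have neq_bd : b != d by apply: contraNneq ad => <-.
pose g (h : disjoint_union (complete_graph 2) (copies 2 (complete_graph 1))) : G :=
  match h with
  | inl i => nth a [:: a; b] (i : 'I_2)
  | inr p => nth c [:: c; d] (p.1 : 'I_2)
  end.
apply: (free_of_embedding (g := g) freeH).
  move=> [[[|[|//]] ?]|[[[|[|//]] ?] [[|//] ?]]]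
         [[[|[|//]] ?]|[[[|[|//]] ?] [[|//] ?]]] //= /eqP;
    rewrite ?[_ == a]eq_sym ?[d == _]eq_sym ?[c == b]eq_sym;
    rewrite ?(negbTE neq_ab) ?(negbTE neq_bc) ?(negbTE neq_ac);
    rewrite ?(negbTE neq_ad) ?(negbTE neq_bd) ?(negbTE neq_cd) // => _;
  by [congr inl; apply: val_inj | congr (inr (_, _)); apply: val_inj].
move=> [[[|[|//]] ?]|[[[|[|//]] ?] [[|//] ?]]]
       [[[|[|//]] ?]|[[[|[|//]] ?] [[|//] ?]]] /=;
  by rewrite ?adj_irrefl ?ab ?(negbTE bc) ?(negbTE ac) ?(negbTE ad) ?(negbTE bd)
       ?(negbTE cd) // adj_sym ?ab ?(negbTE bc) ?(negbTE ac) ?(negbTE ad)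
       ?(negbTE bd) ?(negbTE cd).
Qed.

End Graph.

Theorem theorem7 (H G : sgraph)
  (hH : H = disjoint_union (path_graph 3) (path_graph 1) \/
        H = disjoint_union (complete_graph 2) (copies 2 (complete_graph 1)))
  (hG : free_of H G) :
  secure_domination_number G <= maxn 3 (independence_number G).
Proof.
rewrite leq_max; have [alpha2|alpha3] := leqP (independence_number G) 2.
  by rewrite independence_le2_bound.
have [S indS cardS] := maximum_independent_exists G.
rewrite -cardS secure_domination_number_le ?orbT //.
case: hH hG => -> freeG.
- apply: maximum_independent_secure_of_P3_P1; rewrite ?cardS //.
  by move=> a b c d; apply: P3_P1_free freeG.
- apply: maximum_independent_secure_of_K2_2K1; rewrite ?cardS //.
  by move=> a b c d; apply: K2_2K1_free freeG.
Qed.
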